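(* Let $G$ be a finite group, let $*$ be a nonidentical involutory antiautomorphism of $G$ with $gg^*\in Z(G)$ for every $g\in G$, and let $g_0\in Z(G)$ with $g_0^*=g_0$. Let $\beta\in\{xy,\,x^*y,\,yx,\,yx^*\}$, $\gamma\in\{xy,\,yx\}$ and $\delta\in\{g_0xy,\,g_0xy^*,\,g_0x^*y,\,g_0x^*y^*,\,g_0yx,\,g_0yx^*,\,g_0y^*x,\,g_0y^*x^*\}$. Then the loop $L=Q(G,*,g_0,\beta,\gamma,\delta)$ is an LC-loop if and only if at least one of the following holds: (a) $L$ is a C-loop; (b) $G/Z(G)$ is an elementary abelian $2$-group and $(\beta,\gamma,\delta)$ is among $(xy,yx,g_0yx)$, $(x^*y,xy,g_0x^*y)$, $(yx,xy,g_0xy)$, $(yx^*,yx,g_0yx^* )$; (c) $G$ is commutative, $(xx)^*=xx$ for every $x\in G$, and $(\beta,\gamma,\delta)$ is among $(xy,xy,g_0x^*y)$, $(x^*y,xy,g_0xy)$; (d) $G/Z(G)$ is an elementary abelian $2$-group, $(xx)^*=xx$ for every $x\in G$, and $(\beta,\gamma,\delta)$ is among $(xy,xy,g_0x^*y)$, $(xy,yx,g_0yx^* )$, $(x^*y,xy,g_0xy)$, $(x^*y,yx,g_0yx)$, $(yx,xy,g_0x^*y)$, $(yx,yx,g_0yx^* )$, $(yx^*,xy,g_0xy)$, $(yx^*,yx,g_0yx)$.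
   Context: $Z(G)$ is the center of $G$. An involutory antiautomorphism $*$ of $G$ satisfies $(g^* )^*=g$ and $(gh)^*=h^*g^*$; nonidentical means $g^*\neq g$ for some $g\in G$. A word such as $yx^*$ or $g_0y^*x$ denotes the function $G\times G\to G$ sending $(x,y)$ to the value of the word. Words are regarded as functions: two words are identified when they define the same function on $G\times G$ (for instance $xy$ and $yx$ when $G$ is commutative), and equality of triples $(\beta,\gamma,\delta)$ means equality of the three functions. Let $Gu=\{gu : g\in G\}$ be a disjoint copy of $G$. The loop $Q(G,*,g_0,\beta,\gamma,\delta)$ is the set $G\cup Gu$ with the multiplication, for $x,y\in G$, $$x\circ y=xy,\quad x\circ yu=\beta(x,y)u,\quad xu\circ y=\gamma(x,y)u,\quad xu\circ yu=\delta(x,y).$$ It is a loop with neutral element $1\in G$. The trivial group counts as an elementary abelian $2$-group. A loop is an LC-loop if it satisfies $(xx)(yz)=(x(xy))z$, and a C-loop if it satisfies $((xy)y)z=x(y(yz))$. *)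

(* Defs.v *)
From HB Require Import structures.
From mathcomp Require Import all_boot all_fingroup all_solvable.

Set Implicit Arguments.
Unset Strict Implicit.
Unset Printing Implicit Defensive.

Local Open Scope group_scope.

Section Loops.
Variables (T : Type) (op : T -> T -> T) (e : T).

Definition is_loop : Prop :=
  [/\ left_id e op, right_id e op,
      forall a, bijective (op a) & forall a, bijective (op^~ a)].

Definition LC_loop : Prop :=
  is_loop /\ forall x y z, op (op x x) (op y z) = op (op x (op x y)) z.

Definition C_loop : Prop :=
  is_loop /\ forall x y z, op (op (op x y) y) z = op x (op y (op y z)).

End Loops.

Section Construction.
Variable gT : finGroupType.

Definition involutory_antiautomorphism (star : gT -> gT) : Prop :=
  involutive star /\ forall g h : gT, star (g * h) = star h * star g.

(* Finite functions, so that (boolean or Leibniz) equality of words is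
   equality of the functions G x G -> G that they define. *)
Definition word (f : gT -> gT -> gT) : {ffun gT * gT -> gT} :=
  [ffun p => f p.1 p.2].

(* The carrier G + Gu of the loop: inl x stands for x, and inr x for xu. *)
Definition Qmul (beta gamma delta : {ffun gT * gT -> gT})
    (a b : gT + gT) : gT + gT :=
  match a, b with
  | inl x, inl y => inl (x * y)
  | inl x, inr y => inr (beta (x, y))
  | inr x, inl y => inr (gamma (x, y))
  | inr x, inr y => inl (delta (x, y))
  end.

Definition Qone : gT + gT := inl 1.

End Construction.

Notation "[ 'word' x , y => w ]" := (word (fun x y => w))
  (at level 0, x name, y name, format "[ 'word'  x ,  y  =>  w ]")
  : group_scope.

(* Main.v *)
Require Import Defs.
From HB Require Import structures.
From mathcomp Require Import all_boot all_fingroup all_solvable.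

Set Implicit Arguments.
Unset Strict Implicit.
Unset Printing Implicit Defensive.

Local Open Scope group_scope.

(* A loop is LC as soon as it is left alternative and its squares lie in the
   left nucleus.  The squares of L are the [x x] and either the [g0 x x] or the
   [g0 x^* x], so in cases (b) and (d) they are central elements c of G, with
   c^* = c in case (d), and every required identity is a direct computation.
   Case (c) is contained in case (d).
   Conversely, the LC identity at (xu, y, z) reduces (gamma, delta) to four
   pairs (in the commutative case, after identifying words that define the same
   function), and in each of the 16 remaining cases specializing one or two
   variables to 1 shows as needed that squares are central and fixed by *.
   Four of these cases are not listed in (b) or (d), and give C-loops: one is
   a group, and in the other three squares are central. *)

(** * LC-loops and C-loops in general *)

Section LoopIdentities.
Variables (T : Type) (op : T -> T -> T) (e : T).

Lemma LC_loop_of_squares :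
  is_loop op e ->
  (forall x y, op x (op x y) = op (op x x) y) ->
  (forall x y z, op (op x x) (op y z) = op (op (op x x) y) z) ->
  LC_loop op e.
Proof. by move=> loopT lap nuc; split=> // x y z; rewrite nuc lap. Qed.

Lemma C_loop_of_squares :
  is_loop op e ->
  (forall x y, op x (op x y) = op (op x x) y) ->
  (forall x y, op (op x y) y = op x (op y y)) ->
  (forall x y z, op (op x (op y y)) z = op x (op (op y y) z)) ->
  C_loop op e.
Proof. by move=> loopT lap rap nuc; split=> // x y z; rewrite rap nuc lap. Qed.

Lemma C_loop_of_associative :
  is_loop op e -> associative op -> C_loop op e.
Proof. by move=> loopT opA; split=> // x y z; rewrite !opA. Qed.

(* In a C-loop, squares lie in the middle nucleus; the inverse property carries
   the middle nucleus into the left one: substitute [x = w a^-1] and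
   [z = w^-1 v] in [(x a) z = x (a z)]. *)
Lemma C_loop_LC_loop : C_loop op e -> LC_loop op e.
Proof.
case=> loopT opC; have [op1x opx1 bijl bijr] := loopT.
have lap x y : op x (op x y) = op (op x x) y.
  by have := opC e x y; rewrite !op1x.
have rap x y : op (op x y) y = op x (op y y).
  by have := opC x y e; rewrite !opx1.
have mid x y z : op (op x (op y y)) z = op x (op (op y y) z).
  by rewrite -rap opC lap.
have lip x y w : op x y = e -> op x (op y w) = w.
  move=> xy1; have [h hK Kh] := bijl y.
  (* Here [h] inverts left multiplication by [y], so [z = h w] collapses [op y z] to [w]. *)
  by have := opC x y (h w); rewrite xy1 op1x Kh.
have rip x y w : op x y = e -> op (op w x) y = w.
  move=> xy1; have [h hK Kh] := bijr x.
  by have /= := opC (h w) x y; rewrite xy1 opx1 Kh.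
have inv x : exists2 x', op x x' = e & op x' x = e.
  have [h hK Kh] := bijl x; exists (h e); first exact: Kh.
  (* The left inverse [k e] equals the right inverse [h e], by left cancellation. *)
  have [k kK Kk] := bijr x; have := lip (k e) x (h e) (Kk e).
  by rewrite Kh opx1 => <-; exact: Kk.
apply: LC_loop_of_squares => // x y z; set a := op x x.
have [a' aa' a'a] := inv a; have [w yw wy] := inv y.
set v := op w a'.
have va : op v a = w by exact: rip a'a.
(* The middle nucleus law gives [op v (op a y) = e]; hence [op a y] is the two-sided inverse [r] of
   [v]. *)
have ayv : op (op a y) v = e.
  have := mid v x y; rewrite -/a va wy => vay.
  have [r _ rv] := inv v.
  by rewrite -(lip _ _ (op a y) rv) -vay opx1.
have := mid v x (op y z); rewrite -/a va (lip w y z wy) => E.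
(* [E] reads [z = op v (op a (op y z))], and [op a y] cancels [v]. *)
by rewrite {2}E (lip _ _ _ ayv).
Qed.

End LoopIdentities.

(** * Loop laws on [G + Gu], read off as identities between words *)

Section Doubling.
Variable gT : finGroupType.
Implicit Types (b g d : gT -> gT -> gT) (x y z : gT).

(** The carrier is finite, so translations need only be injective. Each sends the two halves to
    different halves, which leaves injectivity of each word in each variable. *)
Lemma Qmul_is_loop b g d :
  (forall y, b 1 y = y) -> (forall x, g x 1 = x) ->
  (forall x, injective (b x)) -> (forall y, injective (b^~ y)) ->
  (forall x, injective (g x)) -> (forall y, injective (g^~ y)) ->
  (forall x, injective (d x)) -> (forall y, injective (d^~ y)) ->
  is_loop (Qmul (word b) (word g) (word d)) (Qone gT).
Proof.
move=> b1 g1 bl br gl gr dl dr; split.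
- by case=> x /=; rewrite ?ffunE ?mul1g ?b1.
- by case=> x /=; rewrite ?ffunE ?mulg1 ?g1.
- case=> x; apply: injF_bij => -[] y [] z //=; rewrite ?ffunE /= => -[].
  + by move/mulgI->.
  + by move/bl->.
  + by move/gl->.
  + by move/dl->.
- case=> x; apply: injF_bij => -[] y [] z //=; rewrite ?ffunE /= => -[].
  + by move/mulIg->.
  + by move/gr->.
  + by move/br->.
  + by move/dr->.
Qed.

Lemma LC_loop_Qmul b g d :
  LC_loop (Qmul (word b) (word g) (word d)) (Qone gT) ->
  [/\ forall x y z, b (x * x) (b y z) = b (x * x * y) z,
      forall x y z, b (x * x) (g y z) = g (b x (b x y)) z,
      forall x y z, x * x * d y z = d (b x (b x y)) z &
      forall x y, d x x * y = d x (g x y)].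
Proof.
case=> _ lc; split=> [x y z|x y z|x y z|x y].
- by have := lc (inl x) (inl y) (inr z); rewrite /= ?ffunE /= mulgA => -[].
- by have := lc (inl x) (inr y) (inl z); rewrite /= ?ffunE /= => -[].
- by have := lc (inl x) (inr y) (inr z); rewrite /= ?ffunE /= => -[].
- by have := lc (inr x) (inl y) (inl 1); rewrite /= ?ffunE /= !mulg1 => -[].
Qed.

(** [P] is any property shared by all squares of the loop, so that the left nucleus law is checked
    for an abstract [c] in [G]. Each law is split by the halves its arguments lie in; arguments all
    in [G] give nothing new. *)
Lemma LC_loop_Qmul_of_squares (P : gT -> Prop) b g d :
  is_loop (Qmul (word b) (word g) (word d)) (Qone gT) ->
  (forall x, P (x * x)) -> (forall x, P (d x x)) ->
  (forall c x y, P c ->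
     [/\ b c (b x y) = b (c * x) y, b c (g x y) = g (b c x) y &
         c * d x y = d (b c x) y]) ->
  (forall x y,
     [/\ b x (b x y) = b (x * x) y, d x (g x y) = d x x * y &
         g x (d x y) = b (d x x) y]) ->
  LC_loop (Qmul (word b) (word g) (word d)) (Qone gT).
Proof.
move=> loopQ Psq Pd nuc lap; apply: LC_loop_of_squares => //.
  by case=> x [] y; rewrite /= ?ffunE /= ?mulgA //;
    have [] := lap x y; congruence.
move=> a y z; have [c Pc ->] : exists2 c, P c &
    Qmul (word b) (word g) (word d) a a = inl c.
  by case: a => x; [exists (x * x) | exists (d x x)]; rewrite //= ?ffunE.
case: y z => x [] y; rewrite /= ?ffunE /= ?mulgA //;
  by have [] := nuc c x y Pc; congruence.
Qed.

(** Same scheme, with [c] now in the middle nucleus and the right alternative law added. *)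
Lemma C_loop_Qmul_of_squares (P : gT -> Prop) b g d :
  is_loop (Qmul (word b) (word g) (word d)) (Qone gT) ->
  (forall x, P (x * x)) -> (forall x, P (d x x)) ->
  (forall c x y, P c ->
     [/\ b (x * c) y = b x (b c y), g (g x c) y = g x (c * y) &
         d (g x c) y = d x (b c y)]) ->
  (forall x y,
     [/\ b x (b x y) = b (x * x) y, d x (g x y) = d x x * y &
         g x (d x y) = b (d x x) y]) ->
  (forall x y,
     [/\ g (g x y) y = g x (y * y), d (b x y) y = x * d y y &
         b (d x y) y = g x (d y y)]) ->
  C_loop (Qmul (word b) (word g) (word d)) (Qone gT).
Proof.
move=> loopQ Psq Pd nuc lap rap; apply: C_loop_of_squares => //.
- by case=> x [] y; rewrite /= ?ffunE /= ?mulgA //;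
    have [] := lap x y; congruence.
- by case=> x [] y; rewrite /= ?ffunE /= ?mulgA //;
    have [] := rap x y; congruence.
move=> x a z; have [c Pc ->] : exists2 c, P c &
    Qmul (word b) (word g) (word d) a a = inl c.
  by case: a => y; [exists (y * y) | exists (d y y)]; rewrite //= ?ffunE.
case: x z => x [] y; rewrite /= ?ffunE /= ?mulgA //;
  by have [] := nuc c x y Pc; congruence.
Qed.

Lemma quotient_center_abelem2P :
  2.-abelem ([set: gT] / 'Z([set: gT])) <-> forall x y, commute (x * x) y.
Proof.
have nZ x : x \in 'N('Z([set: gT])).
  by rewrite (subsetP (normal_norm (center_normal _))) ?inE.
split=> [/(abelemP (isT : prime 2))[_ sq1] x y | sqC].
  have /sq1: coset 'Z([set: gT]) x \in [set: gT] / 'Z([set: gT]).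
    by rewrite mem_quotient ?inE.
  by rewrite -morphX // => /(coset_idr (nZ _))/centerP[_ /(_ y (in_setT y))].
(* Exponent dividing 2 already forces commutativity. *)
apply: exponent2_abelem; apply/exponentP=> _ /morphimP[x _ _ ->].
rewrite -morphX //; apply: coset_id; apply/centerP; split=> [|y _].
  by rewrite inE.
exact: sqC.
Qed.

End Doubling.

(** * The words built from the antiautomorphism *)

Section Words.
Variables (gT : finGroupType) (star : gT -> gT) (g0 : gT).
Hypothesis starK : involutive star.
Hypothesis starM : forall x y, star (x * y) = star y * star x.
Hypothesis starC : forall x y, commute (x * star x) y.
Hypothesis g0C : forall x, commute g0 x.
Hypothesis g0s : star g0 = g0.
Implicit Types (b g d : gT -> gT -> gT) (x y z : gT).

Lemma star1 : star 1 = 1.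
Proof. by apply: (mulgI (star 1)); rewrite -starM !mulg1. Qed.

Lemma star_mulC x : star x * x = x * star x.
Proof. by apply: (mulgI x); rewrite mulgA; exact: starC. Qed.

Definition beta_words : seq {ffun gT * gT -> gT} :=
  [:: [word x, y => x * y]; [word x, y => star x * y];
      [word x, y => y * x]; [word x, y => y * star x]].

Definition gamma_delta_words :
  seq ({ffun gT * gT -> gT} * {ffun gT * gT -> gT}) :=
  [:: ([word x, y => x * y], [word x, y => g0 * x * y]);
      ([word x, y => x * y], [word x, y => g0 * star x * y]);
      ([word x, y => y * x], [word x, y => g0 * y * x]);
      ([word x, y => y * x], [word x, y => g0 * y * star x])].

Definition words_b :
  seq ({ffun gT * gT -> gT} * {ffun gT * gT -> gT} * {ffun gT * gT -> gT}) :=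
  [:: ([word x, y => x * y], [word x, y => y * x],
       [word x, y => g0 * y * x]);
      ([word x, y => star x * y], [word x, y => x * y],
       [word x, y => g0 * star x * y]);
      ([word x, y => y * x], [word x, y => x * y],
       [word x, y => g0 * x * y]);
      ([word x, y => y * star x], [word x, y => y * x],
       [word x, y => g0 * y * star x])].

Definition words_d :
  seq ({ffun gT * gT -> gT} * {ffun gT * gT -> gT} * {ffun gT * gT -> gT}) :=
  [:: ([word x, y => x * y], [word x, y => x * y],
       [word x, y => g0 * star x * y]);
      ([word x, y => x * y], [word x, y => y * x],
       [word x, y => g0 * y * star x]);
      ([word x, y => star x * y], [word x, y => x * y],
       [word x, y => g0 * x * y]);
      ([word x, y => star x * y], [word x, y => y * x],
       [word x, y => g0 * y * x]);
      ([word x, y => y * x], [word x, y => x * y],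
       [word x, y => g0 * star x * y]);
      ([word x, y => y * x], [word x, y => y * x],
       [word x, y => g0 * y * star x]);
      ([word x, y => y * star x], [word x, y => x * y],
       [word x, y => g0 * x * y]);
      ([word x, y => y * star x], [word x, y => y * x],
       [word x, y => g0 * y * x])].

Lemma word_loop (beta gamma delta : {ffun gT * gT -> gT}) :
  beta \in beta_words ->
  gamma \in [:: [word x, y => x * y]; [word x, y => y * x]] ->
  delta \in [:: [word x, y => g0 * x * y]; [word x, y => g0 * star x * y];
                 [word x, y => g0 * y * x]; [word x, y => g0 * y * star x]] ->
  is_loop (Qmul beta gamma delta) (Qone gT).
Proof.
have starI := inv_inj starK.
rewrite /beta_words !inE => /or4P[]/eqP-> /orP[]/eqP-> /or4P[]/eqP->;
  apply: Qmul_is_loop; rewrite ?star1 => *; rewrite ?star1 ?mulg1 ?mul1g //;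
  (* Outer factors and [star] are peeled off one at a time until the two variables are equal. *)
  move=> x y /=; rewrite -?mulgA;
  by do ?[move/mulgI | move/mulIg | move/starI].
Qed.

Definition central x := forall y, commute x y.

Lemma centralM x y : central x -> central y -> central (x * y).
Proof. by move=> xC yC z; apply/commute_sym/commuteM; apply/commute_sym. Qed.

Lemma central_star x : central x -> central (star x).
Proof. by move=> xC y; rewrite /commute -[y]starK -!starM xC. Qed.

(** Rewrite rules that carry a central factor to the front of a right-nested product. *)
Lemma centralE c : central c ->
  (forall x, x * c = c * x) * (forall x y, x * (c * y) = c * (x * y)).
Proof. by move=> cC; split=> [x|x y]; rewrite ?mulgA cC. Qed.

(** * Sufficiency: the listed words when squares are central *)

Section CentralSquares.
Hypothesis sqC : forall x y, commute (x * x) y.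

(** Normalises right-nested products by carrying the central pairs [x * x] and [x * star x] to the
    front. *)
Lemma pairE :
  (forall x y, y * (x * x) = x * (x * y)) *
  (forall x y, y * (x * star x) = x * (star x * y)) *
  (forall x y, star x * (x * y) = x * (star x * y)) *
  (forall x, star x * x = x * star x).
Proof.
split; last exact: star_mulC.
split=> [|x y]; last by rewrite !mulgA star_mulC.
by split=> x y; rewrite [RHS]mulgA ?sqC ?starC.
Qed.

Lemma pair_starE : (forall x, star (x * x) = x * x) ->
  (forall x y, star x * (star x * y) = x * (x * y)) *
  (forall x, star x * star x = x * x).
Proof.
by move=> starS; split=> [x y|x]; rewrite ?mulgA -starM starS.
Qed.

(** In each triple [beta] and [delta] either both apply [star] to [x] or both do not, so a central
    [c] in [c * d x y = d (b c x) y] comes back unstarred and centrality suffices for [P]. *)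
Lemma LC_loop_words_b (beta gamma delta : {ffun gT * gT -> gT}) :
  (beta, gamma, delta) \in words_b ->
  LC_loop (Qmul beta gamma delta) (Qone gT).
Proof.
have gE := centralE g0C.
rewrite /words_b !inE; do ?[case/predU1P=> [[-> -> ->]|] | case/eqP=> -> -> ->];
  (apply: (@LC_loop_Qmul_of_squares _ central) =>
    [|x|x|c x y cC|x y];
  [ by apply: word_loop; rewrite /beta_words !inE eqxx ?orbT
  | exact: sqC
  | by rewrite -mulgA ?star_mulC; apply: centralM
  | have cE := centralE cC; have scE := centralE (central_star cC);
    by split; rewrite -?mulgA ?starM ?starK -?mulgA ?cE ?scE ?gE
  | by split; rewrite -?mulgA ?starM ?g0s ?starK -?mulgA ?gE ?pairE ]).
Qed.

Lemma C_loop_words (beta gamma delta : {ffun gT * gT -> gT}) :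
  (beta, gamma, delta) \in
     [:: ([word x, y => star x * y], [word x, y => y * x],
          [word x, y => g0 * y * star x]);
         ([word x, y => y * x], [word x, y => y * x],
          [word x, y => g0 * y * x]);
         ([word x, y => y * star x], [word x, y => x * y],
          [word x, y => g0 * star x * y])] ->
  C_loop (Qmul beta gamma delta) (Qone gT).
Proof.
have gE := centralE g0C.
rewrite !inE; do ?[case/predU1P=> [[-> -> ->]|] | case/eqP=> -> -> ->];
  (apply: (@C_loop_Qmul_of_squares _ central) =>
    [|x|x|c x y cC|x y|x y];
  [ by apply: word_loop; rewrite /beta_words !inE eqxx ?orbT
  | exact: sqC
  | by rewrite -mulgA ?star_mulC; apply: centralM
  | have cE := centralE cC; have scE := centralE (central_star cC);
    by split; rewrite -?mulgA ?starM ?starK -?mulgA ?cE ?scE ?gE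
  | by split; rewrite -?mulgA ?starM ?g0s ?starK -?mulgA ?gE ?pairE
  | by split; rewrite -?mulgA ?starM ?g0s ?starK -?mulgA ?gE ?pairE ]).
Qed.

(** In each triple exactly one of [beta] and [delta] applies [star] to [x], so [c] in
    [c * d x y = d (b c x) y] comes back as [star c]; hence [P] also asks for [star c = c]. *)
Lemma LC_loop_words_d (beta gamma delta : {ffun gT * gT -> gT}) :
  (forall x, star (x * x) = x * x) ->
  (beta, gamma, delta) \in words_d ->
  LC_loop (Qmul beta gamma delta) (Qone gT).
Proof.
move=> starS; have starE := pair_starE starS.
have gE := centralE g0C.
rewrite /words_d !inE; do ?[case/predU1P=> [[-> -> ->]|] | case/eqP=> -> -> ->];
  (apply: (@LC_loop_Qmul_of_squares _ (fun c => central c /\ star c = c)) =>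
    [|x|x|c x y [cC cs]|x y];
  [ by apply: word_loop; rewrite /beta_words !inE eqxx ?orbT
  | by split; [exact: sqC | exact: starS]
  | by split=> [y|]; rewrite -mulgA ?star_mulC;
      [apply: centralM | rewrite ?starM ?g0s ?starK ?starE ?gE]
  | have cE := centralE cC; have scE := centralE (central_star cC);
    by split; rewrite -?mulgA ?starM ?starK ?cs -?mulgA ?cE ?scE ?gE
  | by split; rewrite -?mulgA ?starM ?g0s ?starK -?mulgA ?gE ?starE ?pairE ]).
Qed.

End CentralSquares.

(** * Necessity: what the LC identity forces on the words and on [G] *)

(* If [G] is commutative, the other words are equal to these as functions. *)
Lemma LC_loop_gamma_delta b (gamma delta : {ffun gT * gT -> gT}) :
  (exists x, star x <> x) ->
  gamma \in [:: [word x, y => x * y]; [word x, y => y * x]] ->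
  delta \in [:: [word x, y => g0 * x * y]; [word x, y => g0 * x * star y];
                 [word x, y => g0 * star x * y];
                 [word x, y => g0 * star x * star y];
                 [word x, y => g0 * y * x]; [word x, y => g0 * y * star x];
                 [word x, y => g0 * star y * x];
                 [word x, y => g0 * star y * star x]] ->
  LC_loop (Qmul (word b) gamma delta) (Qone gT) ->
  (gamma, delta) \in gamma_delta_words.
Proof.
case=> a nsa; rewrite /gamma_delta_words !inE => gammaE deltaE.
have wordC : (forall x y : gT, x * y = y * x) ->
    ([word x, y => x * y] = [word x, y => y * x] :> {ffun gT * gT -> gT}) *
    ([word x, y => g0 * x * y] = [word x, y => g0 * y * x]) *
    ([word x, y => g0 * star x * y] = [word x, y => g0 * y * star x]).
  move=> gTC; split; [split|];
    by apply/ffunP=> -[x y]; rewrite !ffunE /= -?mulgA ?(gTC x) ?(gTC (star x)).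
case/orP: gammaE => /eqP->; move: deltaE;
  do ?[case/predU1P=> [->|] | move/eqP->];
  case/LC_loop_Qmul=> _ _ _ N5; try by rewrite !eqxx ?orbT.
(* At [x = 1], a [delta] containing [star y] would give [star a = a]. *)
all: try by case: nsa; apply: (mulgI g0); have := N5 1 a;
  rewrite star1 !mulg1 ?mul1g.
(* In the four pairs left, cancelling [g0] and then [x] or [star x] on the left yields
   commutativity. *)
all: have /wordC E x y : x * y = y * x by
  [ have := N5 x y; rewrite -!mulgA; do 2!move/mulgI
  | have := N5 (star x) y; rewrite starK -!mulgA; do 2!move/mulgI ].
all: by rewrite !E !eqxx ?orbT.
Qed.

Lemma LC_loop_words_cases (beta gamma delta : {ffun gT * gT -> gT}) :
  beta \in beta_words ->
  (gamma, delta) \in gamma_delta_words ->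
  LC_loop (Qmul beta gamma delta) (Qone gT) ->
  [\/ C_loop (Qmul beta gamma delta) (Qone gT),
      (forall x, central (x * x)) /\ (beta, gamma, delta) \in words_b |
      [/\ forall x, central (x * x), forall x, star (x * x) = x * x &
      (beta, gamma, delta) \in words_d]].
Proof.
move=> betaE gdE LC; have loopQ := LC.1; move: betaE gdE LC loopQ.
pose norm1 := (star1, star_mulC, starM, starK, mulg1, mul1g).
have sq_of_star x : central (star x * star x) -> central (x * x).
  by move=> sC; rewrite -[x * x]starK starM; apply: central_star.
(* The premise is [N4] at [(x, 1, 1)] when exactly one of [beta] and [delta] applies [star] to
   [x]. *)
have g0_sq x : x * x * g0 = g0 * (star x * star x) -> star (x * x) = x * x.
  by rewrite -g0C => /mulgI; rewrite starM.
rewrite /beta_words /gamma_delta_words /words_b /words_d !inE.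
(* For [beta] equal to [star x * y] or [y * x], the map sending [x] to [beta(x, _)] reverses
   products, so [N2] makes squares central. For the other two it preserves products and [N2] is
   automatic; centrality then comes from [N3] or [N4]. *)
move=> /or4P[]/eqP-> /or4P[]/eqP[-> ->] LC loopQ;
  have [N2 N3 N4 _] := LC_loop_Qmul LC.
(* Here [u] is central with square [g0], so the loop is a group. *)
- constructor 1; apply: C_loop_of_associative => //.
  by case=> x [] y [] z; rewrite /= ?ffunE /= ?mulgA // -?g0C -?mulgA ?g0C.
- have starS x : star (x * x) = x * x.
    by apply: g0_sq; have := N4 x 1 1; rewrite !norm1.
  constructor 3; split=> [x y|//|]; last by rewrite !eqxx ?orbT.
  (* [star] in [delta] reverses [x * x * star y], which puts the square to the right of [y]. *)
  have := N4 x (star y) 1; rewrite !norm1 !mulgA -g0C -!mulgA => /mulgI.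
  by rewrite mulgA -starM starS.
- constructor 2; split=> [x z|]; last by rewrite !eqxx ?orbT.
  by have := N3 x 1 z; rewrite !norm1.
- constructor 3; split=> [x z|x|]; last by rewrite !eqxx ?orbT.
    by have := N3 x 1 z; rewrite !norm1.
  by apply: g0_sq; have := N4 x 1 1; rewrite !norm1.
- constructor 3; split=> [x y|x|]; last by rewrite !eqxx ?orbT.
    by apply: sq_of_star => {}y; have := N2 x (star y) 1; rewrite !norm1.
  by apply: g0_sq; have := N4 x 1 1; rewrite !norm1.
- constructor 2; split=> [x y|]; last by rewrite !eqxx ?orbT.
  by apply: sq_of_star => {}y; have := N2 x (star y) 1; rewrite !norm1.
- constructor 3; split=> [x y|x|]; last by rewrite !eqxx ?orbT.
    by apply: sq_of_star => {}y; have := N2 x (star y) 1; rewrite !norm1.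
  by apply: g0_sq; have := N4 x 1 1; rewrite !norm1.
- constructor 1; apply: C_loop_words => [x y|];
    last by rewrite !inE !eqxx ?orbT.
  by apply: sq_of_star => {}y; have := N2 x (star y) 1; rewrite !norm1.
- constructor 2; split=> [x y|]; last by rewrite !eqxx ?orbT.
  by have := N2 x y 1; rewrite !norm1 => /esym.
- constructor 3; split=> [x y|x|]; last by rewrite !eqxx ?orbT.
    by have := N2 x y 1; rewrite !norm1 => /esym.
  by apply: g0_sq; have := N4 x 1 1; rewrite !norm1.
- constructor 1; apply: C_loop_words => [x y|];
    last by rewrite !inE !eqxx ?orbT.
  by have := N2 x y 1; rewrite !norm1 => /esym.
- constructor 3; split=> [x y|x|]; last by rewrite !eqxx ?orbT.
    by have := N2 x y 1; rewrite !norm1 => /esym.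
  by apply: g0_sq; have := N4 x 1 1; rewrite !norm1.
- constructor 3; split=> [x y|x|]; last by rewrite !eqxx ?orbT.
    by apply: sq_of_star => {}y; have := N3 x 1 y; rewrite !norm1 => /esym.
  by apply: g0_sq; have := N4 x 1 1; rewrite !norm1.
- constructor 1; apply: C_loop_words => [x y|];
    last by rewrite !inE !eqxx ?orbT.
  by apply: sq_of_star => {}y; have := N3 x 1 y; rewrite !norm1 => /esym.
- have starS x : star (x * x) = x * x.
    by apply: g0_sq; have := N4 x 1 1; rewrite !norm1.
  constructor 3; split=> [x y|//|]; last by rewrite !eqxx ?orbT.
  have := N4 x 1 y; rewrite !norm1 mulgA -g0C -!mulgA => /mulgI.
  by rewrite mulgA -starM starS.
- constructor 2; split=> [x y|]; last by rewrite !eqxx ?orbT.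
  have := N4 x 1 y; rewrite !norm1 mulgA -g0C -!mulgA => /mulgI.
  by rewrite mulgA.
Qed.

End Words.

Theorem theorem8p7 (gT : finGroupType) (star : gT -> gT) (g0 : gT)
    (beta gamma delta : {ffun gT * gT -> gT})
    (star_inv : involutory_antiautomorphism star)
    (star_nonid : exists g : gT, star g <> g)
    (star_central : forall g : gT, g * star g \in 'Z([set: gT]))
    (g0_central : g0 \in 'Z([set: gT]))
    (g0_star : star g0 = g0)
    (beta_word : beta \in
       [:: [word x, y => x * y]; [word x, y => star x * y];
           [word x, y => y * x]; [word x, y => y * star x]])
    (gamma_word : gamma \in
       [:: [word x, y => x * y]; [word x, y => y * x]])
    (delta_word : delta \in
       [:: [word x, y => g0 * x * y]; [word x, y => g0 * x * star y];
           [word x, y => g0 * star x * y]; [word x, y => g0 * star x * star y];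
           [word x, y => g0 * y * x]; [word x, y => g0 * y * star x];
           [word x, y => g0 * star y * x];
           [word x, y => g0 * star y * star x]]) :
  LC_loop (Qmul beta gamma delta) (Qone gT) <->
  [\/ C_loop (Qmul beta gamma delta) (Qone gT),
      2.-abelem ([set: gT] / 'Z([set: gT])) /\
      (beta, gamma, delta) \in
        [:: ([word x, y => x * y], [word x, y => y * x],
             [word x, y => g0 * y * x]);
            ([word x, y => star x * y], [word x, y => x * y],
             [word x, y => g0 * star x * y]);
            ([word x, y => y * x], [word x, y => x * y],
             [word x, y => g0 * x * y]);
            ([word x, y => y * star x], [word x, y => y * x],
             [word x, y => g0 * y * star x])],
      [/\ abelian [set: gT],
          forall x : gT, star (x * x) = x * x &
          (beta, gamma, delta) \in
            [:: ([word x, y => x * y], [word x, y => x * y],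
                 [word x, y => g0 * star x * y]);
                ([word x, y => star x * y], [word x, y => x * y],
                 [word x, y => g0 * x * y])]] |
      [/\ 2.-abelem ([set: gT] / 'Z([set: gT])),
          forall x : gT, star (x * x) = x * x &
          (beta, gamma, delta) \in
            [:: ([word x, y => x * y], [word x, y => x * y],
                 [word x, y => g0 * star x * y]);
                ([word x, y => x * y], [word x, y => y * x],
                 [word x, y => g0 * y * star x]);
                ([word x, y => star x * y], [word x, y => x * y],
                 [word x, y => g0 * x * y]);
                ([word x, y => star x * y], [word x, y => y * x],
                 [word x, y => g0 * y * x]);
                ([word x, y => y * x], [word x, y => x * y],
                 [word x, y => g0 * star x * y]);
                ([word x, y => y * x], [word x, y => y * x],
                 [word x, y => g0 * y * star x]);
                ([word x, y => y * star x], [word x, y => x * y],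
                 [word x, y => g0 * x * y]);
                ([word x, y => y * star x], [word x, y => y * x],
                 [word x, y => g0 * y * x])]]].
Proof.
case: star_inv => starK starM.
have starC x y : commute (x * star x) y.
  by have /centerP[_ xC] := star_central x; apply: xC; rewrite inE.
have g0C : central g0.
  by move=> y; have /centerP[_ gC] := g0_central; apply: gC; rewrite inE.
split=> [LC | [CQ | [/quotient_center_abelem2P sqC mem] |
    [/centsP gTC starS mem] | [/quotient_center_abelem2P sqC starS mem]]].
- have [b betaE] : exists b, beta = word b.
    by move: beta_word; rewrite !inE => /or4P[]/eqP->; eexists.
  have := LC; rewrite {1}betaE.
  move/(LC_loop_gamma_delta starK starM star_nonid gamma_word delta_word)=> gdE.
  have [CQ | [sqC mem] | [sqC starS mem]] :=
    LC_loop_words_cases starK starM starC g0C g0_star beta_word gdE LC.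
  + by constructor 1.
  + by constructor 2; split=> //; apply/quotient_center_abelem2P.
  + by constructor 4; split=> //; apply/quotient_center_abelem2P.
- exact: C_loop_LC_loop.
- exact: (LC_loop_words_b starK starM starC g0C g0_star sqC).
- have sqC (x y : gT) : commute (x * x) y by apply: gTC; rewrite inE.
  apply: (LC_loop_words_d starK starM starC g0C g0_star sqC starS).
  by move: mem; rewrite /words_d !inE => /orP[]->; rewrite ?orbT.
- exact: (LC_loop_words_d starK starM starC g0C g0_star sqC).
Qed.
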